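(* Let $N\ge9$, $\alpha\in\{2,3,4\}$ with $\alpha\mid N$, and $M_\alpha=N/\alpha$. Let $g$ be a $2\times5$ matrix over $\mathbb{Z}_N$ generating an admissible linear code, with columns indexed by $i=0,\dots,4$ and $\gcd_i=\gcd(g_{1i},g_{2i},N)$. Suppose exactly two columns of $g$ have $\gcd_i=M_\alpha$ and the other columns have $\gcd_i<M_\alpha$. Then $g$ cannot generate a thin non-degenerate linear code.
   Context: $\mathbb{Z}_N=\mathbb{Z}/N\mathbb{Z}$; its elements are identified with the representatives $0,1,\dots,N-1$, and gcd's are taken of these integers. The code generated by $g$ is the submodule of $\mathbb{Z}_N^5$ generated by the rows of $g$. A linear code is extended if every word has coordinate sum $0\bmod N$; call it admissible if it is extended and the greatest common divisor of $N$ and all entries of all words (equivalently of $N$ and all entries of $g$) is $1$. It is degenerate if some coordinate is zero in all words. An extended code is thin if it contains no word all of whose entries are nonzero. *)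

(* Defs.v *)
From mathcomp Require Import all_boot all_order all_algebra.

Set Implicit Arguments.
Unset Strict Implicit.
Unset Printing Implicit Defensive.

Import GRing.Theory.
Local Open Scope ring_scope.

(* ['Z_N] is the ring of integers modulo N only when [1 < N]. Its elements are
   ordinals, and the coercion to [nat] gives the representatives 0, ..., N-1,
   which are the integers whose gcds are taken below. *)

Definition code (N m n : nat) (g : 'M['Z_N]_(m, n)) : {set 'rV['Z_N]_n} :=
  [set u *m g | u : 'rV['Z_N]_m].

Definition extended (N n : nat) (C : {set 'rV['Z_N]_n}) : bool :=
  [forall w in C, \sum_(j < n) w 0 j == 0].

(* 0 is neutral for [gcdn]: the big operator is the gcd of all entries of all
   words. *)
Definition content (N n : nat) (C : {set 'rV['Z_N]_n}) : nat :=
  \big[gcdn/0%N]_(w in C) \big[gcdn/0%N]_(j < n) (w 0 j : nat).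

Definition admissible (N n : nat) (C : {set 'rV['Z_N]_n}) : bool :=
  extended C && (gcdn N (content C) == 1%N).

Definition degenerate (N n : nat) (C : {set 'rV['Z_N]_n}) : bool :=
  [exists j : 'I_n, [forall w in C, w 0 j == 0]].

Definition thin (N n : nat) (C : {set 'rV['Z_N]_n}) : bool :=
  extended C && ~~ [exists w in C, [forall j : 'I_n, w 0 j != 0]].

Definition colgcd (N n : nat) (g : 'M['Z_N]_(2, n)) (i : 'I_n) : nat :=
  gcdn (gcdn (g 0 i) (g 1 i)) N.

(* Main.v *)
(* The coordinates of words are linear forms f_i on Z_N^2 with sum zero, and
   thinness says that their kernels cover Z_N^2. Let a, b be the two forms of
   order alpha and J = ker a /\ ker b; no other kernel contains J, and every
   coset x + J outside ker a \/ ker b is covered by the three other kernels.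
   As any two of these three meet J in the same subgroup I, such a covering
   forces |J/I| <= 4, and if J/I is not killed by 2 then it is cyclic of order 3
   or 4 and one of the three kernels, ker f_i, meets all these cosets, with
   k J contained in ker f_i for some k <= 3. For alpha = 2, or if 2 kills J/I,
   the exponent N of the group generated by the forms is at most 8. Otherwise
   k f_i vanishes off ker a \/ ker b, hence everywhere because a and b have
   order > 2; so f_i has order at most 3 <= alpha, a contradiction. *)

Require Import Defs.
From HB Require Import structures.
From mathcomp Require Import all_boot all_order all_algebra.

Set Implicit Arguments.
Unset Strict Implicit.
Unset Printing Implicit Defensive.

Import GRing.Theory.
Local Open Scope ring_scope.

Section TwoKernels.

Variables (V R : zmodType) (a b : {additive V -> R}).

Lemma exists_avoid (m : nat) (x1 x2 : V) :
  a (x1 *+ m) != 0 -> b (x2 *+ m) != 0 ->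
  exists x, [/\ a x != 0, b x != 0 & (a (x *+ m) != 0) || (b (x *+ m) != 0)].
Proof.
move=> am1 bm2.
have a1 : a x1 != 0 by apply: contraNneq am1 => a0; rewrite raddfMn a0 mul0rn.
have b2 : b x2 != 0 by apply: contraNneq bm2 => b0; rewrite raddfMn b0 mul0rn.
have [b1|b1] := eqVneq (b x1) 0; last by exists x1; rewrite a1 b1 am1.
have [a2|a2] := eqVneq (a x2) 0; last by exists x2; rewrite a2 b2 bm2 orbT.
exists (x1 + x2); rewrite mulrnDl !raddfD a2 b1 addr0 add0r a1 b2.
by rewrite [a (x2 *+ m)]raddfMn a2 mul0rn addr0 am1.
Qed.

Lemma vanish_off_kernels_sub (psi : {additive V -> R}) (x y : V) :
    (forall v, a v != 0 -> b v != 0 -> psi v = 0) ->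
    a x != 0 -> b x != 0 -> a y = 0 -> psi y != 0 ->
  a (x *+ 2) = 0 /\ b (x *+ 2) = 0.
Proof.
move=> psi0 ax bx ay psiy; have psix := psi0 x ax bx.
have bxDy : b (x + y) = 0.
  apply/eqP; apply: contraNT psiy => nz.
  by rewrite -[y](addKr x) addrC raddfB psix subr0 psi0 // raddfD ay addr0.
have bxBy : b (x - y) = 0.
  apply/eqP; apply: contraNT psiy => nz.
  by rewrite -[y](subKr x) raddfB psix sub0r oppr_eq0 psi0 // raddfB ay subr0.
have b2x : b (x *+ 2) = 0.
  have -> : x *+ 2 = (x + y) + (x - y) by rewrite addrACA subrr addr0.
  by rewrite raddfD bxDy bxBy addr0.
have by0 : b y != 0.
  by apply: contraNneq bx => by0; rewrite -bxDy raddfD by0 addr0.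
split=> //; apply/eqP; apply: contraNT psiy => nz.
have: psi (x *+ 2 + y) = 0 by apply: psi0; rewrite raddfD ?ay ?b2x ?addr0 ?add0r.
by rewrite raddfD raddfMn psix mul0rn add0r => ->.
Qed.

End TwoKernels.

Lemma vanish_off_kernels (V R : zmodType) (a b psi : {additive V -> R})
    (x1 x2 : V) :
    a (x1 *+ 2) != 0 -> b (x2 *+ 2) != 0 ->
    (forall v, a v != 0 -> b v != 0 -> psi v = 0) ->
  forall v, psi v = 0.
Proof.
move=> a1 b2 psi0 y; have [x [ax bx ab2x]] := exists_avoid a1 b2.
have psi0' v : b v != 0 -> a v != 0 -> psi v = 0 by move=> ? ?; apply: psi0.
apply/eqP; apply: contraTT ab2x => psiy; rewrite negb_or !negbK.
have [ay|ay] := eqVneq (a y) 0.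
  by have [-> ->] := vanish_off_kernels_sub psi0 ax bx ay psiy; rewrite !eqxx.
have [by0|by0] := eqVneq (b y) 0; last by rewrite psi0 ?eqxx in psiy.
by have [-> ->] := vanish_off_kernels_sub psi0' bx ax by0 psiy; rewrite !eqxx.
Qed.

Section Cover.

Variables (V : finZmodType) (R : zmodType) (I : finType) (S : {set I}).
Variable f : I -> {additive V -> R}.

Definition joint_ker : {pred V} := [pred y | [forall s in S, f s y == 0]].

Definition avoids (x : V) : bool := [forall s in S, f s x != 0].

Hypothesis card3 : #|~: S| = 3%N.
Hypothesis sum0 : forall v, \sum_i f i v = 0.
Hypothesis cover : forall v, exists i, f i v = 0.
Hypothesis proper : forall i, i \notin S -> exists2 y, y \in joint_ker & f i y != 0.

Lemma joint_kerP y : reflect {in S, forall s, f s y = 0} (y \in joint_ker).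
Proof.
apply: (iffP forall_inP) => [h s sS | h s sS]; first exact/eqP/h.
exact/eqP/h.
Qed.

Lemma joint_kerD y z :
  y \in joint_ker -> z \in joint_ker -> y + z \in joint_ker.
Proof.
move=> /joint_kerP yJ /joint_kerP zJ; apply/joint_kerP => s sS.
by rewrite raddfD yJ ?zJ ?addr0.
Qed.

Lemma joint_kerMn y n : y \in joint_ker -> y *+ n \in joint_ker.
Proof.
by move=> /joint_kerP yJ; apply/joint_kerP => s sS; rewrite raddfMn yJ ?mul0rn.
Qed.

Lemma avoidsD x y : avoids x -> y \in joint_ker -> avoids (x + y).
Proof.
move=> /forall_inP xA /joint_kerP yJ; apply/forall_inP => s sS.
by rewrite raddfD yJ ?addr0 ?xA.
Qed.

Lemma avoids_cover x : avoids x -> exists2 k, k \notin S & f k x = 0.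
Proof.
move=> /forall_inP xA; have [k fk0] := cover x; exists k => //.
by apply/negP => /xA; rewrite fk0 eqxx.
Qed.

Lemma pigeonhole (i j k l : I) :
    i \notin S -> j \notin S -> k \notin S -> l \notin S ->
  [|| i == j, i == k, i == l, j == k, j == l | k == l].
Proof.
move=> iS jS kS lS; apply: contraT => h.
have u : uniq [:: i; j; k; l].
  by move: h; rewrite /= !inE !negb_or -!andbA andbT.
have: (size [:: i; j; k; l] <= size (enum (~: S)))%N.
  apply: uniq_leq_size u _ => t.
  by rewrite mem_enum !inE => /or4P [] /eqP ->.
by rewrite -cardE card3.
Qed.

Lemma joint_ker_two_zeros i j y :
    i \notin S -> j \notin S -> i != j -> y \in joint_ker ->
    f i y = 0 -> f j y = 0 ->
  forall k, f k y = 0.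
Proof.
move=> iS jS ij /joint_kerP yJ fi fj k; have [/yJ //|kS] := boolP (k \in S).
have [->|ki] := eqVneq k i; first exact: fi.
have [->|kj] := eqVneq k j; first exact: fj.
have := sum0 y; rewrite (bigD1 k) //= big1 ?addr0 // => l lk.
have [/yJ //|lS] := boolP (l \in S).
move: (pigeonhole kS iS jS lS).
rewrite (negPf ki) (negPf kj) (negPf ij) [k == l]eq_sym (negPf lk) /=.
by case/orP=> /eqP <-.
Qed.

(* Move to a point of the coset where [f i] does not vanish: its translates by
   0, y and 2y then share only two kernels. *)
Lemma joint_ker_double x i y :
    avoids x -> i \notin S -> y \in joint_ker -> f i y = 0 ->
  forall k, f k (y *+ 2) = 0.
Proof.
move=> xA iS yJ fiy.
have [w wA fiw] : exists2 w, avoids w & f i w != 0.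
  have [fix0|] := eqVneq (f i x) 0; last by exists x.
  have [y' y'J fiy'] := proper iS; exists (x + y'); first exact: avoidsD.
  by rewrite raddfD fix0 add0r.
have miss n k : f k (w + y *+ n) = 0 -> (i == k) = false.
  by apply: contra_eqF => /eqP <-; rewrite raddfD raddfMn fiy mul0rn addr0.
have color n := avoids_cover (avoidsD wA (joint_kerMn n yJ)).
have [k0 k0S f0] := color 0; have [k1 k1S f1] := color 1.
have [k2 k2S f2] := color 2.
have dbl k : k \notin S -> i != k -> f k y = 0 -> forall l, f l (y *+ 2) = 0.
  move=> kS ik fky l; rewrite raddfMn.
  by rewrite (joint_ker_two_zeros iS kS ik yJ) ?mul0rn.
move: (pigeonhole iS k0S k1S k2S).
rewrite (miss _ _ f0) (miss _ _ f1) (miss _ _ f2) /=.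
case/or3P=> /eqP e; rewrite -e in f1 f2.
- apply: (dbl k0) => //; first by rewrite (miss _ _ f0).
  by move: f1; rewrite mulr1n raddfD -[w]addr0 f0 add0r.
- apply: (joint_ker_two_zeros iS k0S) => //; first by rewrite (miss _ _ f0).
  + exact: joint_kerMn.
  + by rewrite raddfMn fiy mul0rn.
  + by move: f2; rewrite raddfD -[w]addr0 f0 add0r.
- apply: (dbl k1) => //; first by rewrite (miss _ _ f1).
  by move: f2; rewrite mulrSr addrA raddfD -{1}[y]mulr1n f1 add0r.
Qed.

Lemma hit_progression x z i :
    avoids x -> z \in joint_ker -> (exists k, f k (z *+ 2) != 0) ->
    i \notin S ->
    (forall k, k \notin S -> k != i -> f k (z *+ 2) != 0) ->
  exists2 n, (n < 3)%N & f i (x + z *+ n) = 0.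
Proof.
move=> xA zJ [l flz] iS hz.
have fz k : k \notin S -> f k z != 0.
  by move=> kS; apply: contra_neq flz => fkz; apply: (joint_ker_double xA kS).
have color n := avoids_cover (avoidsD xA (joint_kerMn n zJ)).
have [k0 k0S f0] := color 0; have [k1 k1S f1] := color 1.
have [k2 k2S f2] := color 2.
have [e|ik0] := eqVneq k0 i; first by exists 0%N; rewrite // -e.
have [e|ik1] := eqVneq k1 i; first by exists 1%N; rewrite // -e.
have [e|ik2] := eqVneq k2 i; first by exists 2%N; rewrite // -e.
move: (pigeonhole iS k0S k1S k2S).
rewrite ![i == _]eq_sym (negPf ik0) (negPf ik1) (negPf ik2) /=.
case/or3P=> /eqP e; rewrite -e in f1 f2.
- by case/eqP: (fz k0 k0S); move: f1; rewrite mulr1n raddfD -[x]addr0 f0 add0r.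
- by case/eqP: (hz k0 k0S ik0); move: f2; rewrite raddfD -[x]addr0 f0 add0r.
- case/eqP: (fz k1 k1S); move: f2.
  by rewrite mulrSr addrA raddfD -{1}[z]mulr1n f1 add0r.
Qed.

Lemma joint_ker_dichotomy x :
    avoids x ->
  (forall y, y \in joint_ker -> forall l, f l (y *+ 2) = 0) \/
  exists i k m, [/\ i \notin S, (0 < k <= 3)%N, (0 < m <= 4)%N,
    forall y, y \in joint_ker ->
      f i (y *+ k) = 0 /\ (forall l, f l (y *+ m) = 0)
    & forall w, avoids w -> exists2 y, y \in joint_ker & f i (w + y) = 0].
Proof.
move=> xA.
have [/forall_inP dbl|] := boolP [forall y in joint_ker, [forall l, f l (y *+ 2) == 0]].
  by left=> y /dbl /forallP h l; apply/eqP.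
rewrite negb_forall_in => /exists_inP [z zJ]; rewrite negb_forall => z2; right.
have nz2 : exists k, f k (z *+ 2) != 0 by apply/existsP.
have hits i : i \notin S -> (forall k, k \notin S -> k != i -> f k (z *+ 2) != 0) ->
    forall w, avoids w -> exists2 y, y \in joint_ker & f i (w + y) = 0.
  move=> iS hz w wA; have [n _ fn] := hit_progression wA zJ nz2 iS hz.
  by exists (z *+ n) => //; apply: joint_kerMn.
have shift i : i \notin S -> (forall k, k \notin S -> k != i -> f k (z *+ 2) != 0) ->
    forall y, y \in joint_ker -> exists2 n, (n < 3)%N & f i (y + z *+ n) = 0.
  move=> iS hz y yJ; have [y' y'J fy'] := hits i iS hz x xA.
  have wA := avoidsD (avoidsD xA y'J) yJ.
  have [n n3 fn] := hit_progression wA zJ nz2 iS hz; exists n => //.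
  by move: fn; rewrite -addrA raddfD fy' add0r.
have [/existsP [i /andP [iS /eqP fi2]]|] := boolP [exists i, (i \notin S) && (f i (z *+ 2) == 0)].
  have hz k : k \notin S -> k != i -> f k (z *+ 2) != 0.
    move=> kS ki; have [l fl] := nz2; apply: contra_neq fl => fk2.
    exact: (joint_ker_two_zeros kS iS ki (joint_kerMn 2 zJ)).
  have fiy2 y : y \in joint_ker -> f i (y *+ 2) = 0.
    move=> yJ; have [n _ fn] := shift i iS hz y yJ.
    have := congr1 (fun r => r *+ 2) fn.
    rewrite -raddfMn mulrnDl mulrnAC raddfD [f i (z *+ 2 *+ n)]raddfMn fi2.
    by rewrite !mul0rn addr0.
  exists i, 2%N, 4%N; split=> //; last exact: hits.
  move=> y yJ; split=> [|l]; first exact: fiy2.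
  by rewrite (mulrnA y 2 2) (joint_ker_double xA iS (joint_kerMn 2 yJ)) ?fiy2.
rewrite negb_exists => /forallP h.
have fz2 k : k \notin S -> f k (z *+ 2) != 0.
  by move=> kS; have := h k; rewrite kS.
have hz i k : k \notin S -> k != i -> f k (z *+ 2) != 0 by move=> kS _; apply: fz2.
have fz k : k \notin S -> f k z != 0.
  by move=> kS; apply: contra_neq (fz2 k kS); rewrite raddfMn => ->; rewrite mul0rn.
have f3 i : i \notin S -> f i (z *+ 3) = 0.
  move=> iS; have [[|[|[|//]]] _] := shift i iS (hz i) z zJ.
  - by rewrite addr0 => e; have := fz i iS; rewrite e eqxx.
  - by rewrite -mulrS => e; have := fz2 i iS; rewrite e eqxx.
  - by rewrite -mulrS.
have fy3 i y : y \in joint_ker -> f i (y *+ 3) = 0.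
  move=> yJ; have [iS|iS] := boolP (i \in S).
    by move/joint_kerP: yJ => yJ; rewrite raddfMn yJ ?mul0rn.
  have [n _ fn] := shift i iS (hz i) y yJ.
  have := congr1 (fun r => r *+ 3) fn.
  rewrite -raddfMn mulrnDl mulrnAC raddfD [f i (z *+ 3 *+ n)]raddfMn f3 //.
  by rewrite !mul0rn addr0.
have [i] : exists i, i \in ~: S by apply/set0Pn; rewrite -card_gt0 card3.
rewrite inE => iS; exists i, 3%N, 3%N; split=> //; last exact/hits/hz.
by move=> y yJ; split=> [|l]; apply: fy3.
Qed.

End Cover.

Lemma cover_exponent (V : finZmodType) (R : zmodType) (I : finType)
    (S : {set I}) (f : I -> {additive V -> R}) (alpha : nat) :
    #|~: S| = 3%N -> #|S| = 2%N -> (1 < alpha <= 4)%N ->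
    (forall v, \sum_i f i v = 0) -> (forall v, exists i, f i v = 0) ->
    (forall s v, s \in S -> f s (v *+ alpha) = 0) ->
    (forall s k, s \in S -> (0 < k < alpha)%N -> exists v, f s (v *+ k) != 0) ->
    (forall i k, i \notin S -> (0 < k <= alpha)%N -> exists v, f i (v *+ k) != 0) ->
  exists2 k, (0 < k <= 8)%N & forall v i, f i (v *+ k) = 0.
Proof.
move=> card3 /eqP/cards2P [a [b [ab defS]]] /andP [a1 a4] sum0 cover ordS ltS ltC.
have aS : a \in S by rewrite defS !inE eqxx.
have bS : b \in S by rewrite defS !inE eqxx orbT.
have avoidsE v : avoids S f v = (f a v != 0) && (f b v != 0).
  apply/forall_inP/andP => [h|[fav fbv] s]; first by rewrite !h.
  by rewrite defS !inE => /orP [] /eqP ->.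
have alphaJ v : v *+ alpha \in joint_ker S f.
  by apply/joint_kerP => s sS; apply: ordS.
have proper i : i \notin S -> exists2 y, y \in joint_ker S f & f i y != 0.
  move=> iS; have [|v fv] := ltC i alpha iS; first by rewrite leqnn ltnW.
  by exists (v *+ alpha).
have [x1 fx1] := ltS a 1%N aS a1; have [x2 fx2] := ltS b 1%N bS a1.
have [x [fax fbx _]] := exists_avoid fx1 fx2.
have xA : avoids S f x by rewrite avoidsE fax.
have [dbl|] := joint_ker_dichotomy card3 sum0 cover proper xA.
  exists (alpha * 2)%N => [|v i]; last by rewrite mulrnA dbl.
  by rewrite muln_gt0 ltnW //= -[8%N]/(4 * 2)%N leq_mul2r.
case=> i [k [m [iS /andP [k0 k3] /andP [m0 m4] kill hits]]].
have [a3|a2] := leqP 3 alpha; last first.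
  exists (alpha * m)%N => [|v j]; last by rewrite mulrnA; have [_ ->] := kill _ (alphaJ v).
  by rewrite muln_gt0 ltnW //= m0 -[8%N]/(2 * 4)%N leq_mul.
have [v /eqP []] : exists v, f i (v *+ k) != 0.
  by apply: ltC => //; rewrite k0 (leq_trans k3).
have [y1 fy1] := ltS a 2%N aS a3; have [y2 fy2] := ltS b 2%N bS a3.
have psiB : zmod_morphism (fun v => f i (v *+ k)).
  by move=> u w; rewrite mulrnBl raddfB.
pose psiM := GRing.isZmodMorphism.Build V R _ psiB.
pose psi : {additive V -> R} := HB.pack (fun v => f i (v *+ k)) psiM.
apply: (vanish_off_kernels (psi := psi) fy1 fy2) => w faw fbw /=.
have wA : avoids S f w by rewrite avoidsE faw.
have [y yJ fwy] := hits w wA; have [fyk _] := kill y yJ.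
rewrite -[w](addrK y) mulrnBl raddfB fyk subr0.
by rewrite raddfMn fwy mul0rn.
Qed.

Definition word_coord (N m n : nat) (g : 'M['Z_N]_(m, n)) (j : 'I_n)
  (v : 'rV['Z_N]_m) : 'Z_N := (v *m g) 0 j.

Lemma word_coord_is_zmod_morphism (N m n : nat) (g : 'M['Z_N]_(m, n)) (j : 'I_n) :
  zmod_morphism (word_coord g j).
Proof. by move=> u v; rewrite /word_coord mulmxBl !mxE. Qed.

HB.instance Definition _ (N m n : nat) (g : 'M['Z_N]_(m, n)) (j : 'I_n) :=
  GRing.isZmodMorphism.Build _ _ (word_coord g j) (word_coord_is_zmod_morphism g j).

Lemma Zp_mulrn_eq0 (N : nat) (x : 'Z_N) (k : nat) :
  (1 < N)%N -> (x *+ k == 0) = (N %| k * x)%N.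
Proof.
move=> N1; rewrite -[x in LHS]natr_Zp -mulrnA mulnC -(inj_eq val_inj) /=.
by rewrite val_Zp_nat // /dvdn.
Qed.

Lemma word_coord_mulrn_eq0 (N n : nat) (g : 'M['Z_N]_(2, n)) (j : 'I_n) (k : nat) :
  (1 < N)%N ->
  reflect (forall v, word_coord g j (v *+ k) = 0) (N %| k * colgcd g j)%N.
Proof.
move=> N1; have -> : (N %| k * colgcd g j)%N = (g 0 j *+ k == 0) && (g 1 j *+ k == 0).
  by rewrite /colgcd !muln_gcdr !dvdn_gcd (dvdn_mull k (dvdnn N)) andbT !Zp_mulrn_eq0.
apply: (iffP andP) => [[/eqP g0 /eqP g1] v | h].
  rewrite raddfMn /= /word_coord mxE big_ord_recl big_ord1 mulrnDl -!mulrnAr g0.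
  rewrite (_ : lift _ _ = 1) ?g1; last exact/val_inj.
  by rewrite !mulr0 addr0.
have gE i : g i j *+ k = word_coord g j (delta_mx 0 i *+ k).
  by rewrite raddfMn /= /word_coord -rowE mxE.
by rewrite !gE !h.
Qed.

Lemma dvdn_mul_content (N m n : nat) (g : 'M['Z_N]_(m, n)) (k : nat) :
    (1 < N)%N -> (forall v j, word_coord g j (v *+ k) = 0) ->
  (N %| k * content (code g))%N.
Proof.
move=> N1 h.
have gcdP x y : (N %| k * x -> N %| k * y -> N %| k * gcdn x y)%N.
  by rewrite muln_gcdr dvdn_gcd => -> ->.
apply: (big_ind (fun c => N %| k * c)%N) => [|//|w]; first by rewrite muln0.
case/imsetP=> v _ ->; apply: (big_ind (fun c => N %| k * c)%N) => [|//|j _].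
  by rewrite muln0.
by have /eqP := h v j; rewrite raddfMn Zp_mulrn_eq0.
Qed.

Theorem lemma3p7 (N alpha : nat) (hN : (9 <= N)%N)
    (halpha : alpha \in [:: 2; 3; 4]%N) (hdvd : (alpha %| N)%N)
    (g : 'M['Z_N]_(2, 5)) (hadm : admissible (code g))
    (htwo : #|[set i : 'I_5 | colgcd g i == (N %/ alpha)%N]| = 2%N)
    (hother : forall i : 'I_5, colgcd g i <> (N %/ alpha)%N ->
                (colgcd g i < N %/ alpha)%N) :
  ~ (thin (code g) /\ ~ degenerate (code g)).
Proof.
case=> thing _; have N1 : (1 < N)%N by apply: leq_trans hN.
have N0 : (0 < N)%N by apply: ltnW.
have alphaB : (1 < alpha <= 4)%N by move: halpha; rewrite !inE => /or3P [] /eqP ->.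
have alpha0 : (0 < alpha)%N by case/andP: alphaB => /ltnW.
have divK : (alpha * (N %/ alpha) = N)%N by rewrite mulnC divnK.
have colgcd_gt0 i : (0 < colgcd g i)%N by rewrite gcdn_gt0 N0 orbT.
pose S := [set i : 'I_5 | colgcd g i == (N %/ alpha)%N].
have in_code v : v *m g \in code g by apply/imsetP; exists v.
have [/forall_inP ext /eqP cont] := andP hadm.
have nonzero i k : (0 < k)%N -> (k * colgcd g i < N)%N ->
    exists v, word_coord g i (v *+ k) != 0.
  move=> k0 kN; apply/existsP; apply: contraLR kN; rewrite negb_exists -leqNgt.
  move=> /forallP h; apply: dvdn_leq; first by rewrite muln_gt0 k0 colgcd_gt0.
  by apply/(word_coord_mulrn_eq0 g i k N1) => v; have := h v; rewrite negbK => /eqP.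
have [||||||k /andP [k0 k8] kill] :=
    @cover_exponent _ _ _ S (fun i => word_coord g i) alpha _ htwo alphaB.
- by rewrite cardsCs setCK htwo card_ord.
- by move=> v; apply/eqP/ext.
- move=> v; case/andP: thing => _; rewrite negb_exists => /forallP /(_ (v *m g)).
  rewrite in_code /= negb_forall => /existsP [i]; rewrite negbK => /eqP.
  by exists i.
- move=> s v; rewrite inE => /eqP sS; apply/(word_coord_mulrn_eq0 g s alpha N1).
  by rewrite sS divK.
- move=> s k; rewrite inE => /eqP sS /andP [k0 ka]; apply: nonzero => //.
  by rewrite sS -{2}divK ltn_pmul2r // divn_gt0 // dvdn_leq.
- move=> i k; rewrite inE => /eqP/hother iS /andP [k0 ka]; apply: nonzero => //.
  have: (alpha * colgcd g i < alpha * (N %/ alpha))%N by rewrite ltn_pmul2l.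
  by rewrite divK; apply/leq_ltn_trans/leq_mul.
have: (N %| k * gcdn N (content (code g)))%N.
  by rewrite muln_gcdr dvdn_gcd (dvdn_mull k (dvdnn N)) dvdn_mul_content.
by rewrite cont muln1 => /(dvdn_leq k0); rewrite leqNgt (leq_ltn_trans k8).
Qed.
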